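(* Fix an integer $d\ge 3$ and a positive integer $n$, and put $a=d-1$, $q_k=1+a+\cdots+a^{k-1}$. Let $\bar B_n$ be the multigraph obtained from the ball of radius $n+1$ (around a root vertex) in the infinite $d$-regular tree by identifying all vertices at distance $n+1$ from the root to a single sink vertex (keeping all edges, so parallel edges arise), with no edge added between the root and the sink. Let $p$ be a prime not dividing $d(d-1)$, let $t_p$ be the least positive integer $m$ with $p \mid q_m$, and let $S_p(n)$ be the Sylow $p$-subgroup of the sandpile group $SP(\bar B_n)$. Then the rank of $S_p(n)$ (the minimal number of generators, i.e. the number of cyclic factors in its decomposition) is \[ \mathrm{rank}(S_p(n)) = \begin{cases} d(d-2)\displaystyle\sum_{\substack{0\le m<n\\ m\equiv n \ (\mathrm{mod}\ t_p)}} (d-1)^m, & n\not\equiv -1 \pmod{t_p},\\[2ex] d(d-2)\displaystyle\sum_{\substack{0\le m<n\\ m\equiv n\ (\mathrm{mod}\ t_p)}} (d-1)^m + d-1, & n\equiv -1 \pmod{t_p}.\end{cases} \]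
   Context: For a finite multigraph $G$ (no loops) with vertices $x_1,\dots,x_N$ and sink $x_N$, the reduced Laplacian $\Delta$ is the $(N-1)\times(N-1)$ integer matrix with $\Delta_{ii}=-\deg(x_i)$ and $\Delta_{ij}$ equal to the number of edges between $x_i$ and $x_j$ for $i\ne j$; the sandpile group is $SP(G)=\mathbb{Z}^{N-1}/\Delta\mathbb{Z}^{N-1}$. *)

(* Defs.v *)
From HB Require Import structures.
From mathcomp Require Import all_boot all_order all_fingroup all_algebra.
From mathcomp Require Import all_solvable.
From mathcomp Require Import boolp.
From mathcomp Require Import zify ring.

Set Implicit Arguments.
Unset Strict Implicit.
Unset Printing Implicit Defensive.

Import Order.TTheory GRing.Theory Num.Theory.
Local Open Scope ring_scope.

(* Connectedness (equivalent, by symmetry, to every vertex being joined to    *)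
(* the sink) is what makes the sandpile group finite.                         *)
Record multigraph := Multigraph {
  vertex :> finType;
  sink : vertex;
  mult : vertex -> vertex -> nat;
  mult_sym : forall x y, mult x y = mult y x;
  mult_loopless : forall x, mult x x = 0%N;
  connected_to_sink : forall x, connect [rel u v | (0 < mult u v)%N] x sink }.

Section Sandpile.
Variable G : multigraph.

Definition degree (x : G) : nat := (\sum_(y : G) mult x y)%N.

(* The index set 'I_#|nonsink| enumerates x_1, ..., x_{N-1} via enum_val.     *)
Definition nonsink := [pred x : G | x != sink G].

Definition reduced_laplacian : 'M[int]_#|nonsink| :=
  \matrix_(i, j) if i == j then - (degree (enum_val i))%:Z
                 else (mult (enum_val i) (enum_val j))%:Z.

Definition laplacian_image : {pred 'cV[int]_#|nonsink|} :=
  [pred u | `[< exists v : 'cV[int]_#|nonsink|, u = reduced_laplacian *m v >]].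

Lemma laplacian_imageP (u : 'cV[int]_#|nonsink|) :
  reflect (exists v : 'cV[int]_#|nonsink|, u = reduced_laplacian *m v)
          (u \in laplacian_image).
Proof. exact: asboolP. Qed.

Lemma laplacian_image_zmod_closed : zmod_closed laplacian_image.
Proof.
split; first by apply/laplacian_imageP; exists 0; rewrite mulmx0.
move=> u v /laplacian_imageP[u' ->] /laplacian_imageP[v' ->].
by apply/laplacian_imageP; exists (u' - v'); rewrite mulmxBr.
Qed.

HB.instance Definition _ :=
  GRing.isZmodClosed.Build _ laplacian_image laplacian_image_zmod_closed.

Definition sandpile : Type := Quotient.quot laplacian_image.

HB.instance Definition _ := Quotient.on sandpile.
HB.instance Definition _ := GRing.Zmodule.on sandpile.

Lemma det_reduced_laplacian_neq0 : \det reduced_laplacian != 0.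
Proof.
apply/negP => /det0P[v vN0 vL0].
pose f (x : G) : int :=
  oapp (fun i => v 0 i) 0 [pick i : 'I_#|nonsink| | enum_val i == x].
have fE i : f (enum_val i) = v 0 i.
  rewrite /f; case: pickP => [j /eqP/enum_val_inj -> //|/(_ i)].
  by rewrite eqxx.
have fs : f (sink G) = 0.
  rewrite /f; case: pickP => // j /eqP js.
  by have := enum_valP j; rewrite js inE eqxx.
have harm x : x != sink G ->
    (degree x)%:Z * f x = \sum_(y : G) (mult x y)%:Z * f y.
  move=> xs; have xin : x \in nonsink by rewrite inE.
  pose i := enum_rank_in xin x.
  have xi : x = enum_val i by rewrite enum_rankK_in.
  have := congr1 (fun w : 'rV_#|nonsink| => w 0 i) vL0.
  rewrite !mxE (bigD1 i) //= mxE eqxx -xi mulrN => /eqP.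
  rewrite addrC subr_eq0 -fE -xi mulrC => /eqP <-.
  rewrite (bigD1 (sink G)) //= fs mulr0 add0r.
  rewrite (big_enum_val (A := nonsink) (fun y => (mult x y)%:Z * f y)).
  rewrite [RHS](bigD1 i) //= -xi mult_loopless mul0r add0r.
  apply: eq_bigr => j ji; rewrite mxE (negPf ji) fE mulrC -xi.
  by rewrite mult_sym.
have [i0 vi0] : exists i0, v 0 i0 != 0 by apply/rV0Pn.
pose x0 : G := [arg max_(x > sink G) `|f x|%R]%O.
have maxf y : `|f y| <= `|f x0|.
  by rewrite /x0; case: arg_maxP => // x _; apply.
have M0 : 0 < `|f x0|.
  by apply: lt_le_trans (maxf (enum_val i0)); rewrite normr_gt0 fE.
have step x y : `|f x| = `|f x0| -> (0 < mult x y)%N -> `|f y| = `|f x0|.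
  move=> fx xy; apply/le_anti; rewrite maxf /= leNgt; apply/negP => lty.
  have xs : x != sink G.
    by apply: contraTneq M0 => xs; rewrite -fx xs fs normr0 ltxx.
  have := harm x xs => /(congr1 (fun z => `|z|)).
  rewrite normrM [`|_%:Z|]ger0_norm // fx => eqf.
  suff: `|\sum_(z : G) (mult x z)%:Z * f z| < (degree x)%:Z * `|f x0|.
    by rewrite -eqf ltxx.
  apply: le_lt_trans (ler_norm_sum _ _ _) _.
  rewrite /degree (big_morph Posz PoszD (erefl _)) mulr_suml.
  rewrite (bigD1 y) //= [ltRHS](bigD1 y) //=.
  apply: ltr_leD; first by rewrite normrM [`|_%:Z|]ger0_norm // ltr_pM2l // ltz_nat.
  by apply: ler_sum => z _; rewrite normrM [`|_%:Z|]ger0_norm // ler_wpM2l.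
have /connectP[w pw lw] := connected_to_sink x0.
have walk s : forall x, path [rel u v | (0 < mult u v)%N] x s ->
    `|f x| = `|f x0| -> `|f (last x s)| = `|f x0|.
  elim: s => //= y s IH x /andP[xy ys] fx.
  exact: IH ys (step _ _ fx xy).
by have := walk w x0 pw erefl; rewrite -lw fs normr0 => /eqP; rewrite lt_eqF.
Qed.

(* Each class is determined by the residues of a representative modulo        *)
(* |det Delta|, because det(Delta) * e = Delta * (adj(Delta) * e).            *)
Let D := `|\det reduced_laplacian|%N.-1.

Let repr_mx (x : sandpile) : 'cV[int]_#|nonsink| := generic_quotient.repr x.

Let residues (x : sandpile) : {ffun 'I_#|nonsink| -> 'I_D.+1} :=
  [ffun i => inord `|((repr_mx x) i ord0 %% \det reduced_laplacian)%Z|%N].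

Let of_residues (r : {ffun 'I_#|nonsink| -> 'I_D.+1}) : sandpile :=
  (\pi_sandpile (\col_i (r i : nat)%:Z))%qT.

Let residuesK : cancel residues of_residues.
Proof.
move=> x; rewrite /of_residues -[RHS]reprK; apply/eqP.
rewrite -(Quotient.idealrBE laplacian_image).
pose e : 'cV[int]_#|nonsink| :=
  \col_i ((repr_mx x) i ord0 %/ \det reduced_laplacian)%Z.
apply/laplacian_imageP; exists (\adj reduced_laplacian *m (- e)).
rewrite mulmxA mul_mx_adj mul_scalar_mx; apply/colP => i; rewrite !mxE ffunE.
have dN0 := det_reduced_laplacian_neq0.
have D1 : D.+1 = `|\det reduced_laplacian|%N by rewrite prednK // absz_gt0.
rewrite inordK; last first.
  by rewrite D1 -ltz_nat gez0_abs ?modz_ge0 // abszE ltz_mod.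
rewrite gez0_abs ?modz_ge0 //.
by rewrite {2}(divz_eq ((repr_mx x) i ord0) (\det reduced_laplacian)); ring.
Qed.

HB.instance Definition _ : isCountable sandpile := CanIsCountable residuesK.
HB.instance Definition _ : isFinite sandpile := CanIsFinite residuesK.
HB.instance Definition _ := [finGroupMixin of sandpile for +%R].
End Sandpile.

Section RegularTree.
Variable d : nat.

(* The infinite d-regular tree with its edges properly d-coloured: a vertex   *)
(* is the word of colours read along the geodesic to it from the root, last   *)
(* step first, so that [::] is the root and consecutive colours differ.       *)
Definition tree := {w : seq 'I_d | sorted (fun i j => i != j) w}.

Definition root : tree := Sub [::] isT.

Definition tree_adj : rel tree := fun u v =>
  [exists i, val v == i :: val u] || [exists i, val u == i :: val v].

Definition level (w : tree) : nat := size (val w).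

Lemma tree_adj_sym : symmetric tree_adj.
Proof. by move=> u v; rewrite /tree_adj orbC. Qed.

Lemma tree_adj_level u v : tree_adj u v ->
  level v = (level u).+1 \/ level u = (level v).+1.
Proof.
by case/orP=> /existsP[i /eqP E]; [left | right]; rewrite /level E.
Qed.

Lemma tree_child (w : tree) (i : 'I_d) : ohead (val w) != Some i ->
  exists2 v : tree, val v = i :: val w & tree_adj w v.
Proof.
move=> wi; have vP : sorted (fun i j => i != j) (i :: val w).
  case: w wi => -[|j w] //= wP wi; rewrite wP andbT.
  by apply: contraNneq wi => ->.
exists (Sub (i :: val w) vP) => //.
by apply/orP; left; apply/existsP; exists i.
Qed.

Lemma tree_regular (w : tree) : exists s : seq tree,
  [/\ uniq s, size s = d & forall v, (v \in s) = tree_adj w v].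
Proof.
pose up : seq (seq 'I_d) := if val w is _ :: w' then [:: w'] else [::].
pose down := [seq i :: val w | i <- enum 'I_d & ohead (val w) != Some i].
have upP u : u \in up = [exists i, val w == i :: u].
  rewrite /up; case: (val w) => [|j w'].
    by rewrite in_nil; apply/esym/existsP=> -[i].
  rewrite inE; apply/eqP/existsP => [->|[i /eqP[_ ->]] //].
  by exists j.
have downP u : u \in down ->
    sorted (fun i j => i != j) u && [exists i, u == i :: val w].
  case/mapP=> i; rewrite mem_filter => /andP[/tree_child[v vE _] _] ->.
  by rewrite -vE (valP v) vE; apply/existsP; exists i.
have upS u : u \in up -> sorted (fun i j => i != j) u.
  rewrite upP => /existsP[i /eqP E].
  by have := valP w; rewrite /= E => /path_sorted.
exists (pmap insub (up ++ down)); split.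
- apply: pmap_sub_uniq; rewrite cat_uniq; apply/and3P; split.
  + by rewrite /up; case: (val w).
  + apply/hasPn => u /downP/andP[_ /existsP[i /eqP uE]].
    rewrite upP; apply/existsP => -[j /eqP wE].
    have := congr1 size uE; rewrite wE /= => /eqP.
    by rewrite eqn_leq ltnNge leqnSn andbF.
  + by rewrite map_inj_uniq => [|i j []//]; apply/filter_uniq/enum_uniq.
- rewrite size_pmap_sub (eq_in_count (a2 := predT)); last first.
    by move=> u; rewrite mem_cat => /orP[/upS|/downP/andP[->]].
  rewrite count_predT size_cat size_map size_filter /up.
  case: (val w) => [|j w'] /=; first by rewrite count_predT size_enum_ord.
  rewrite (eq_count (a2 := predC (pred1 j))).
    rewrite -[RHS](size_enum_ord d) -(count_predC (pred1 j)) count_uniq_mem.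
      by rewrite mem_enum.
    exact: enum_uniq.
  by move=> i /=; rewrite eq_sym.
move=> v; rewrite mem_pmap_sub mem_cat upP /tree_adj orbC; congr orb.
apply/idP/idP => [/downP/andP[]//|/existsP[i /eqP vE]].
rewrite vE; apply/mapP; exists i => //.
rewrite mem_filter mem_enum andbT.
have := valP v; rewrite /= vE /=; case: (sval w) => //= j w' /andP[ij _].
by apply: contraNneq ij => -[->].
Qed.

Lemma tree_acyclic (c : seq tree) : ucycle tree_adj c -> (size c <= 2)%N.
Proof.
move=> /andP[cy un]; rewrite leqNgt; apply/negP => c3.
have [x xc xmax] :
    exists2 x, x \in c & forall y, y \in c -> (level y <= level x)%N.
  elim: c {cy un} c3 => // x0 [|x1 c] IH _.
    by exists x0; [exact: mem_head | move=> y; rewrite inE => /eqP->].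
  have [x xc xmax] : exists2 x, x \in x1 :: c &
      forall y, y \in x1 :: c -> (level y <= level x)%N.
    case: c IH => [_|x2 [|x3 c] IH]; last exact: IH.
      by exists x1; [exact: mem_head | move=> y; rewrite inE => /eqP->].
    have [l12|l21] := leqP (level x1) (level x2); [exists x2 | exists x1];
      rewrite ?inE ?eqxx ?orbT // => y; rewrite !inE => /orP[]/eqP-> //.
    exact: ltnW.
  have [l0|l0] := leqP (level x0) (level x); [exists x | exists x0].
  - by rewrite in_cons xc orbT.
  - by move=> y; rewrite in_cons => /orP[/eqP->//|/xmax].
  - exact: mem_head.
  - move=> y; rewrite in_cons => /orP[/eqP->//|/xmax yx].
    exact: leq_trans yx (ltnW l0).
have parent u : tree_adj x u -> u \in c -> exists i, val x = i :: val u.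
  move=> xu /xmax; rewrite leqNgt => lux.
  case/orP: xu => /existsP[i /eqP E]; last by exists i.
  by rewrite /level E /= ltnS leqnn in lux.
have [k c' cE] := rot_to xc.
have memc u : u \in c' -> u \in c.
  by move=> uc; rewrite -(mem_rot k) cE in_cons uc orbT.
move: cy un c3; rewrite -(rot_cycle k) -(rot_uniq k) -(size_rot k) cE.
case: c' memc {cE} => [|y c'] // memc /=.
case/lastP: c' memc => [|c' z] // memc.
rewrite rcons_path last_rcons => /and3P[xy _ zx] /and3P[_ yz _] _.
have [i yE] := parent y xy (memc y (mem_head _ _)).
have zc : z \in y :: rcons c' z by rewrite in_cons mem_rcons mem_head orbT.
have xz : tree_adj x z by rewrite tree_adj_sym.
have [j zE] := parent z xz (memc z zc).
case/negP: yz; suff -> : y = z by rewrite mem_rcons mem_head.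
by apply: val_inj; move: zE; rewrite yE => -[].
Qed.

Lemma tree_dist (w : tree) :
  (exists s, [/\ path tree_adj root s, last root s = w & size s = level w]) /\
  (forall s, path tree_adj root s -> last root s = w -> (level w <= size s)%N).
Proof.
split; last first.
  have bound s : forall v : tree, path tree_adj v s ->
      (level (last v s) <= level v + size s)%N.
    elim: s => [|u s IH] v /=; first by rewrite addn0.
    case/andP=> /tree_adj_level vu /IH; case: vu => ->; lia.
  by move=> s /bound; rewrite [level root]/= add0n => + sw; rewrite sw.
move: {2}(level w) (erefl (level w)) => k; elim: k w => [|k IH] w wk.
  by exists [::]; split; rewrite ?wk //; apply/val_inj/esym/size0nil.
move: wk (valP w); rewrite /level /=; case wE: (val w) => [|i u] //= [uk] iuP.
have [s [ps ls ss]] := IH (Sub u (path_sorted iuP)) uk.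
exists (rcons s w); split; rewrite ?last_rcons ?size_rcons ?ss //.
rewrite rcons_path ps ls /=; apply/orP; left; apply/existsP; exists i.
exact/eqP.
Qed.

Definition ball (r : nat) := {w : tree | (level w <= r)%N}.

HB.instance Definition _ r := SubCountable.on (ball r).

Let ball_bseq r (w : ball r) : r.-bseq 'I_d := Bseq (valP w : size _ <= r)%N.
Let bseq_ball r (w : r.-bseq 'I_d) : option (ball r) :=
  obind insub (insub (val w) : option tree).

Let ball_bseqK r : pcancel (@ball_bseq r) (@bseq_ball r).
Proof. by move=> w; rewrite /bseq_ball /= valK /= valK. Qed.

HB.instance Definition _ r : isFinite (ball r) := PCanIsFinite (@ball_bseqK r).
End RegularTree.

Section CollapsedBall.
Variables (d n : nat).

(* The vertices of Bbar are those of the ball of radius n together with the   *)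
(* sink None, to which the sphere of radius n + 1 is collapsed.               *)
Definition collapse (w : ball d n.+1) : option (ball d n) := insub (val w).

(* Each edge joining the fibres of x <> y is counted once, oriented from x    *)
(* to y; no edge has both ends in one fibre (Bbar_mult_loopless).             *)
Definition Bbar_mult (x y : option (ball d n)) : nat :=
  #|[set e : ball d n.+1 * ball d n.+1 |
      [&& collapse e.1 == x, collapse e.2 == y
        & tree_adj (val e.1) (val e.2)]]|.

Lemma Bbar_mult_sym x y : Bbar_mult x y = Bbar_mult y x.
Proof.
rewrite /Bbar_mult -!sum1dep_card (reindex_inj (h := fun e => (e.2, e.1))).
  by apply: eq_bigl => -[u v] /=; rewrite tree_adj_sym andbCA.
by move=> [u v] [u' v'] /= [-> ->].
Qed.

Lemma collapse_level x (w : ball d n.+1) : collapse w = Some x -> val x = val w.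
Proof. by rewrite /collapse; case: insubP => // u _ <- [->]. Qed.

Lemma collapse_sink (w : ball d n.+1) :
  (collapse w == None) = (level (val w) == n.+1).
Proof.
rewrite /collapse; case: insubP => [u /= uP _|]; last first.
  by rewrite -ltnNge eqn_leq (valP w) => ->.
by rewrite eqn_leq ltnNge uP andbF.
Qed.

Lemma Bbar_mult_loopless x : Bbar_mult x x = 0%N.
Proof.
apply/eqP; rewrite cards_eq0; apply/eqP/setP=> -[u v]; rewrite !inE /=.
apply/negP => /and3P[/eqP ux /eqP vx uv].
have : level (val u) = level (val v).
  case: x ux vx => [x|] ux vx.
    by rewrite -(collapse_level ux) -(collapse_level vx).
  by move: ux vx => /eqP + /eqP; rewrite !collapse_sink => /eqP-> /eqP->.
by case: (tree_adj_level uv) => -> /eqP;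
  rewrite ?[_ == _.+1]eq_sym eqn_leq ltnn ?andbF.
Qed.

Hypothesis hd : (2 < d)%N.

Lemma Bbar_connected x :
  connect [rel u v | (0 < Bbar_mult u v)%N] x None.
Proof.
have child (w : ball d n) : exists2 v : ball d n.+1,
    level (val v) = (level (val w)).+1 & tree_adj (val w) (val v).
  have [i wi] : exists i : 'I_d, ohead (val (val w)) != Some i.
    case: (val (val w)) => [|j u]; first by exists (Ordinal (ltnW (ltnW hd))).
    have [i ij] : exists i, i != j.
      have [j0|j0] := eqVneq (j : nat) 0%N.
        by exists (Ordinal (ltnW hd)); rewrite -val_eqE /= j0.
      by exists (Ordinal (ltnW (ltnW hd))); rewrite -val_eqE /= eq_sym.
    by exists i; apply: contraNneq ij => -[->].
  have [v vE wv] := tree_child wi.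
  have lv : level v = (level (val w)).+1 by rewrite /level vE.
  have vn : (level v <= n.+1)%N by rewrite lv; exact: valP w.
  by exists (Sub v vn).
have child_edge (w : ball d n) (v : ball d n.+1) :
    tree_adj (val w) (val v) -> (0 < Bbar_mult (Some w) (collapse v))%N.
  move=> wv; have wn : (level (val w) <= n.+1)%N by apply: leqW; exact: valP w.
  apply/card_gt0P; exists (Sub (val w) wn, v); rewrite inE /= wv eqxx !andbT.
  by rewrite /collapse /= valK.
case: x => // w; have [k] : exists k, (n - level (val w))%N = k by eexists.
elim: k w => [|k IH] w kE; have wn : (level (val w) <= n)%N := valP w.
  have lw : level (val w) = n by lia.
  have [v vl /child_edge] := child w.
  have -> : collapse v = None by apply/eqP; rewrite collapse_sink vl lw.
  exact: connect1.
have [v vl /child_edge wv] := child w.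
case vE : (collapse v) wv => [x|] wv; last exact: connect1.
apply: connect_trans (connect1 wv) (IH x _).
by rewrite (collapse_level vE) vl subnS kE.
Qed.

Definition Bbar : multigraph :=
  Multigraph Bbar_mult_sym Bbar_mult_loopless Bbar_connected.
End CollapsedBall.

Definition geom (a k : nat) : nat := (\sum_(i < k) a ^ i)%N.

(* Main.v *)
Require Import Defs.
From mathcomp Require Import all_boot all_order all_fingroup all_algebra.
From mathcomp Require Import all_solvable.
From mathcomp Require Import zify ring.

(* The rank of the Sylow p-subgroup is the dimension over F_p of the          *)
(* p-torsion of Z^(N-1) / Delta, hence of the kernel of Delta mod p, i.e. of  *)
(* the space of functions on the ball of radius n, extended by 0 to the       *)
(* sphere of radius n + 1, that are harmonic mod p. Consider an a-ary subtree *)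
(* with h levels above the sink and the functions on it that are harmonic for *)
(* a prescribed value c at the parent of its top. By induction on h, the      *)
(* pairs (value at the top, c) that they realise form the line spanned by     *)
(* (q_h, q_(h+1)): if q_(h+1) <> 0 mod p, the values at the children of a     *)
(* vertex of height h + 1 are determined by the value at that vertex;         *)
(* otherwise this value is 0 and the values at its a children are free, which *)
(* adds a - 1 to the dimension k_(h+1) of the functions for which both the    *)
(* top value and c are 0. Thus k_(h+1) = a k_h + (a - 1) [t | h + 1]. At the  *)
(* root d such subtrees meet, and d a <> 0 mod p forces the value there to be *)
(* 0; what remains has dimension d k_n, plus d - 1 if p divides q_(n+1).      *)

Set Implicit Arguments.
Unset Strict Implicit.
Unset Printing Implicit Defensive.

Import GRing.Theory.
Local Open Scope ring_scope.

(** * Torsion of the sandpile group *)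

(** Dimensions over F_p appear as exponents of cardinalities. The rank is the logarithm of the
    number of kernel vectors of the Laplacian mod p ([grank_Sylow_abelian], [card_Ldiv_sandpile]).
    These vectors correspond to harmonic trees ([card_ker_Bbar], [card_ball_harmonic]), whose number
    obeys a recursion on the height ([card_harmonic], [card_harmonic_root]). The recursion gains a
    term exactly at the heights divisible by t ([dvdn_geom]), and [kernel_dimE] solves it. *)

(** For an abelian p-group the minimal number of generators is log_p of the order of its p-torsion,
    and the p-torsion of the whole group already lies in [S]. *)
Lemma grank_Sylow_abelian (gT : finGroupType) (p : nat) (G S : {group gT}) :
  prime p -> abelian G -> p.-Sylow(G)%g S ->
  'm(S)%g = logn p #|('Ldiv_p(G))%g|.
Proof.
move=> pr_p abG sylS; have sSG := pHall_sub sylS; have abS := abelianS sSG abG.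
rewrite grank_abelian // (rank_pgroup (pHall_pgroup sylS)) p_rank_abelian //.
have -> : ('Ldiv_p(G) = 'Ldiv_p(S))%g.
  apply/setP => x; rewrite !inE; case: eqP => xp; rewrite ?andbF // !andbT.
  have [xG|xG] := boolP (x \in G); last by rewrite (contraNF (subsetP sSG x)).
  rewrite (mem_normal_Hall sylS) //.
    2: by rewrite /normal sSG sub_abelian_norm.
  by apply/esym/(pnat_dvd _ (pnat_id pr_p)); rewrite order_dvdn; apply/eqP.
rewrite (OhmE 1 (pHall_pgroup sylS)) expn1 (@gen_set_id _ 'Ldiv_p(S)%g) //.
apply/group_setP; split; first by rewrite !inE group1 expg1n eqxx.
move=> x y /LdivP[xS xp] /LdivP[yS yp]; apply/LdivP; split; first exact: groupM.
by rewrite expgMn ?xp ?yp ?mulg1 //; apply: (centsP abS).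
Qed.

Lemma intr_valFp (p : nat) (x : 'F_p) : (x : nat)%:Z%:~R = x.
Proof. exact: natr_Zp. Qed.

Section TorsionAsKernel.
Variables (G : multigraph) (p : nat).
Hypothesis pr_p : prime p.

Let L := reduced_laplacian G.
Let red (m n : nat) (A : 'M[int]_(m, n)) : 'M['F_p]_(m, n) := map_mx intr A.
Let lift (m n : nat) (A : 'M['F_p]_(m, n)) : 'M[int]_(m, n) :=
  map_mx (fun x : 'F_p => (x : nat)%:Z) A.

Let liftK m n : cancel (@lift m n) (@red m n).
Proof. by move=> A; apply/matrixP => i j; rewrite !mxE intr_valFp. Qed.

Let red_eq0 m n (A : 'M[int]_(m, n)) :
  reflect (exists B : 'M[int]_(m, n), A = p%:Z *: B) (red A == 0).
Proof.
apply: (iffP eqP) => [A0|[B ->]]; last first.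
  by apply/matrixP => i j; rewrite !mxE intrM -pmulrn pchar_Fp_0 ?mul0r.
exists (map_mx (divz ^~ p%:Z) A); apply/matrixP => i j; rewrite !mxE mulrC.
rewrite divzK //; have /eqP := congr1 (fun M : 'M_(m, n) => M i j) A0.
by rewrite !mxE -(dvdz_pcharf (pchar_Fp pr_p)).
Qed.

Let laplacian_inj (n : nat) (u : 'M[int]_(_, n)) : L *m u = 0 -> u = 0.
Proof.
move=> /(congr1 (mulmx (\adj L))); rewrite mulmxA mul_adj_mx mulmx0.
rewrite mul_scalar_mx => /eqP; rewrite scalemx_eq0.
by rewrite (negPf (det_reduced_laplacian_neq0 G)) => /eqP.
Qed.

Let p_neq0 : p%:Z != 0 :> int.
Proof. by rewrite eqz_nat -lt0n prime_gt0. Qed.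

Let pi_eq (u v : 'cV[int]_#|nonsink G|) :
  reflect (exists w, u - v = L *m w)
    ((\pi_(sandpile G) u == \pi_(sandpile G) v)%qT).
Proof.
rewrite -(Quotient.idealrBE (@laplacian_image G)).
exact: (iffP (laplacian_imageP _)).
Qed.

Let pi0 : (\pi_(sandpile G) 0)%qT = 0.
Proof. exact: (raddf0 (\pi_(Quotient.quot (@laplacian_image G)))%qT). Qed.

Let piMn (u : 'cV[int]_#|nonsink G|) (m : nat) :
  (\pi_(sandpile G) (u *+ m))%qT = (\pi_(sandpile G) u)%qT *+ m.
Proof. exact: (raddfMn (\pi_(Quotient.quot (@laplacian_image G)))%qT). Qed.

(* A class killed by [p] is represented by [Delta w / p] for a [w] in the     *)
(* kernel of [Delta] mod [p], unique mod [p] because [Delta] is injective.    *)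
Lemma card_Ldiv_sandpile :
  #|('Ldiv_p([set: sandpile G]))%g| =
  #|[set w : 'cV['F_p]_#|nonsink G| | map_mx intr L *m w == 0]|.
Proof.
pose f (w : 'cV['F_p]_#|nonsink G|) : sandpile G :=
  (\pi_(sandpile G) (map_mx (divz ^~ p%:Z) (L *m lift w)))%qT.
have fP w : map_mx intr L *m w = 0 ->
    exists2 v, p%:Z *: v = L *m lift w & f w = (\pi_(sandpile G) v)%qT.
  move=> w0; have /red_eq0[v vE] : red (L *m lift w) == 0.
    by rewrite /red map_mxM -/(red _) -/(red (lift w)) liftK w0.
  exists v => //; congr (\pi_(sandpile G) _)%qT.
  apply/matrixP=> i j; rewrite mxE vE mxE mulrC mulzK //.
rewrite -(card_in_imset (f := f)); last first.
  move=> w w'; rewrite !inE => /eqP/fP[v vE ->] /eqP/fP[v' vE' ->].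
  move=> /eqP/pi_eq[u uE].
  (* Injectivity of [f]: if the two quotients by p differ by [L *m u], cancelling [L] shows that the
     lifts differ by p u. *)
  have /eqP : L *m (lift w - lift w' - p%:Z *: u) = 0.
    by rewrite !mulmxBr -scalemxAr -vE -vE' -uE -scalerBr subrr.
  move=> /eqP/laplacian_inj/eqP; rewrite subr_eq0 => /eqP wE.
  rewrite -[w]liftK -[w']liftK; apply/eqP; rewrite -subr_eq0.
  rewrite /red -map_mxB; apply/red_eq0; by exists u.
apply: eq_card => x; rewrite inE in_setT /=.
apply/idP/imsetP => [|[w]]; last first.
  rewrite !inE => /eqP/fP[v vE ->] ->.
  rewrite FinRing.zmodXgE -piMn -scaler_nat.
  rewrite FinRing.zmod1gE -pi0.
  apply/pi_eq; exists (lift w); rewrite subr0 -vE; congr (_ *: _).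
  by rewrite natz.
rewrite inE FinRing.zmodXgE FinRing.zmod1gE => /eqP.
rewrite -[x]reprK; set V := generic_quotient.repr x => xp.
have [w wE] : exists w, V *+ p - 0 = L *m w.
  by apply/pi_eq; rewrite piMn pi0 xp.
have w0 : map_mx intr L *m red w = 0.
  rewrite -map_mxM -wE subr0; apply/eqP/red_eq0; exists V.
  by rewrite -scaler_nat natz.
exists (red w); first by rewrite inE w0.
have [v vE ->] := fP _ w0; apply/eqP/pi_eq.
(* Replacing [w] by the lift of its reduction changes it by some p u, hence the quotient by p
   changes by [L *m u], which is zero in the group. *)
have /red_eq0[u uE] : red (w - lift (red w)) == 0.
  by rewrite /red map_mxB -/(red _) -/(red (lift _)) liftK subrr.
exists u; apply: (scalemx_inj p_neq0).
by rewrite scalerBr vE scalemxAr -uE mulmxBr -wE subr0 -scaler_nat natz.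
Qed.

End TorsionAsKernel.

(** * Counting harmonic functions on trees *)

Section ConstrainedSums.
Variables (K : finFieldType) (I : finType) (P : pred I).
Hypothesis P_gt0 : (0 < #|P|)%N.

(** All coordinates in [P] but one are free, and the sum determines the last one. *)
Lemma card_supported_sum (z : K) :
  #|[set s : {ffun I -> K} | [forall i, P i || (s i == 0)] &
      \sum_i s i == z]| = (#|K| ^ #|P|.-1)%N.
Proof.
have [i0 Pi0] : exists i0, i0 \in P by apply/card_gt0P.
have -> : #|P|.-1 = #|[predD1 P & i0]| by rewrite (cardD1 i0) Pi0.
rewrite -(card_pffun_on (0 : K) [predD1 P & i0] predT).
pose h (s : {ffun I -> K}) : {ffun I -> K} :=
  [ffun i => if i == i0 then z - \sum_(j | j != i0) s j else s i].
have pffP (s : {ffun I -> K}) :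
    reflect (s i0 = 0 /\ forall i, ~~ P i -> s i = 0)
    (s \in pffun_on (0 : K) [predD1 P & i0] predT).
  apply: (iffP pffun_onP) => [[/supportP s0 _]|[s0 sP]].
    split; first by apply: s0; rewrite !inE eqxx.
    move=> i Pi; apply: s0; rewrite !inE negb_and orbC.
    by rewrite (_ : i \in P = false) // unfold_in (negPf Pi).
  split=> //; apply/supportP => i; rewrite !inE negb_and negbK.
  by case/orP=> [/eqP-> //|/sP].
rewrite -(card_in_imset (f := h)
  (D := [in pffun_on (0 : K) [predD1 P & i0] predT])).
  apply: eq_card => s; rewrite !inE.
  apply/andP/imsetP => [[/forallP sP /eqP sz]|].
    exists [ffun i => if i == i0 then 0 else s i].
      apply/pffP; split=> [|i Pi]; rewrite ffunE ?eqxx //.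
      by case: eqP => // _; have := sP i; rewrite (negPf Pi) => /eqP.
    apply/ffunP => i; rewrite ffunE; case: eqP => [->|/eqP ii0]; last first.
      by rewrite ffunE (negPf ii0).
    rewrite -sz (bigD1 i0) //= [X in _ - X](eq_bigr s) ?addrK // => j ji0.
    by rewrite ffunE (negPf ji0).
  case=> s' /pffP[s0 sP] ->; split.
    apply/forallP => i; rewrite ffunE.
    case: (i =P i0) => [->|_]; first by rewrite (Pi0 : P i0).
    by case Pi: (P i) => //=; rewrite sP ?Pi.
  rewrite (bigD1 i0) //= ffunE eqxx.
  rewrite [X in _ - _ + X](eq_bigr s') ?subrK // => j ji0.
  by rewrite ffunE (negPf ji0).
move=> s s' /pffP[s0 _] /pffP[s0' _] /ffunP hE; apply/ffunP => i.
by have := hE i; rewrite !ffunE; case: eqP => // ->; rewrite s0 s0'.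
Qed.

(** If [al] is nonzero, only the vector with entries e / al on [P] is left, and its sum has to be z;
    if [al] is 0, the condition on the entries is vacuous or contradictory. *)
Lemma card_proportional_sum (al e z : K) :
  #|[set s : {ffun I -> K} |
      [forall i, if P i then al * s i == e else s i == 0] & \sum_i s i == z]| =
  if al == 0 then ((e == 0)%R * #|K| ^ #|P|.-1)%N
  else nat_of_bool (#|P|%:R * e == al * z)%R.
Proof.
case: (eqVneq al 0) => [->|al0].
  have [->|e0] := eqVneq e 0.
    rewrite mul1n -(card_supported_sum z); apply: eq_card => s; rewrite !inE.
    by congr (_ && _); apply: eq_forallb => i; rewrite mul0r eqxx; case: (P i).
  apply/eqP; rewrite cards_eq0; apply/eqP/setP => s; rewrite !inE.
  have /card_gt0P[i0 Pi0] := P_gt0.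
  apply/negP => /andP[/forallP/(_ i0)]; rewrite (Pi0 : P i0) mul0r eq_sym.
  by rewrite (negPf e0).
pose s0 : {ffun I -> K} := [ffun i => if P i then e / al else 0].
have s0z : \sum_i s0 i = #|P|%:R * (e / al).
  under eq_bigr do rewrite ffunE.
  by rewrite -big_mkcond sumr_const mulr_natl.
have -> : (#|P|%:R * e == al * z) = (\sum_i s0 i == z).
  rewrite s0z -(inj_eq (mulfI al0) (_ * (_ / _))).
  by rewrite mulrCA [al * (e / al)]mulrC divfK.
transitivity #|[set s : {ffun I -> K} | (s == s0) && (\sum_i s0 i == z)]|.
  apply: eq_card => s; rewrite !inE.
  apply/andP/andP => [[/forallP sP sz]|[/eqP-> sz]].
    suff /eqP sE : s == s0 by rewrite -sE eqxx.
    apply/eqP/ffunP => i; rewrite ffunE; have := sP i; case: (P i) => /eqP //.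
    by move=> <-; rewrite mulrC mulKf.
  split=> //; apply/forallP => i; rewrite ffunE; case: (P i); rewrite ?eqxx //.
  by rewrite mulrC divfK.
case: (_ == z); last first.
  by rewrite (eq_card0 (A := [set _ | _])) // => s; rewrite !inE andbF.
by rewrite (eq_card (B := [set s0])) ?cards1 // => s; rewrite !inE andbT.
Qed.

(** Sorting the families by their vector of values [rt], each admissible vector has [M] choices of
    branch at every index of [P] and one elsewhere. *)
Lemma card_family_sum (T : finType) (rt : T -> K) (S : I -> pred T) (M : nat)
    (al e z : K) (t0 : T) :
  (forall i s, P i ->
     #|[set t | S i t & rt t == s]| = (M * (al * s == e)%R)%N) ->
  (forall i, ~~ P i -> S i =1 pred1 t0) -> rt t0 = 0 ->
  #|[set g : {ffun I -> T} | [forall i, S i (g i)] & \sum_i rt (g i) == z]| =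
  (M ^ #|P| * if (al == 0)%R then ((e == 0)%R * #|K| ^ #|P|.-1)%N
              else nat_of_bool (#|P|%:R * e == al * z)%R)%N.
Proof.
move=> SP SnP rt0; rewrite -card_proportional_sum -sum1dep_card.
pose rs (g : {ffun I -> T}) : {ffun I -> K} := [ffun i => rt (g i)].
rewrite (partition_big rs (fun s => \sum_i s i == z)) /=; last first.
  by move=> g /andP[_ /eqP <-]; apply/eqP/eq_bigr => i _; rewrite ffunE.
transitivity (\sum_(s : {ffun I -> K} | (\sum_i s i == z)%R)
   \prod_i (if P i then M * (al * s i == e)%R else (s i == 0)%R))%N.
  apply: eq_bigr => s /eqP sz; rewrite sum1dep_card.
  transitivity #|family (fun i => [pred t | S i t & rt t == s i])|.
    apply: eq_card => g; rewrite !inE.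
    apply/andP/familyP => [[/andP[/forallP gS _] /eqP gs] i|gF].
      by rewrite inE gS -gs ffunE eqxx.
    have rsE : rs g = s.
      apply/ffunP=> i; rewrite ffunE.
      by have := gF i; rewrite inE => /andP[_ /eqP].
    rewrite rsE eqxx -[X in _ == X]sz -rsE; split=> //; apply/andP; split.
      by apply/forallP => i; have := gF i; rewrite inE => /andP[].
    by apply/eqP/eq_bigr => i _; rewrite ffunE.
  rewrite card_family foldrE big_map big_enum /=; apply: eq_bigr => i _.
  case: ifPn => Pi.
    by rewrite -(SP i (s i) Pi); apply: eq_card => t; rewrite !inE.
  rewrite (eq_card (B := [set t | (t == t0) && (s i == 0)])); last first.
    move=> t; rewrite !inE unfold_in /= (SnP i Pi t) /=.
    case: (t =P t0) => // ->.
    by rewrite rt0 eq_sym.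
  case: (s i == 0); last by rewrite eq_card0 // => t; rewrite !inE andbF.
  by rewrite (eq_card (B := [set t0])) ?cards1 // => t; rewrite !inE andbT.
rewrite -sum1dep_card big_distrr /= [RHS]big_mkcond [LHS]big_mkcond /=.
apply: eq_bigr => s _; rewrite andbC; case: eqP => //= _; rewrite muln1.
case: ifP => [/forallP sP|/negbT/forallPn[i]]; last first.
  by rewrite (bigD1 i) //=; case: (P i) => /negPf->; rewrite ?muln0 mul0n.
rewrite -prod_nat_const [RHS]big_mkcond /=; apply: eq_bigr => i _; have := sP i.
by rewrite [i \in P]unfold_in; case: (P i) => ->; rewrite ?muln1.
Qed.

End ConstrainedSums.

(** * Recursive count of harmonic trees by height *)

Section HarmonicTrees.
Variables (K : finFieldType) (d : nat).
Hypothesis d_gt2 : (2 < d)%N.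

(* A tree of height [h] records the values of a function on a vertex and its  *)
(* descendants in the next [h - 1] levels; the function is [0] further down.  *)
(* Every colour labels a child, also that of the edge to the parent: the      *)
(* corresponding subtree is required to be zero in [harmonic].                *)
Fixpoint vtree (h : nat) : finType :=
  if h is h'.+1 then (K * {ffun 'I_d -> vtree h'})%type else unit.

Definition top_value (h : nat) : vtree h -> K :=
  if h is _.+1 then fun t => t.1 else fun _ => 0.

Fixpoint zero_vtree (h : nat) : vtree h :=
  if h is h'.+1 then (0, [ffun => zero_vtree h']) else tt.

(** [up] is the colour of the edge to the parent, [None] at the root, and [c] is the value at the
    parent. *)
Fixpoint harmonic (h : nat) (up : option 'I_d) (c : K) : vtree h -> bool :=
  if h is h'.+1 then fun t =>
    [forall i, if Some i != up then harmonic (Some i) t.1 (t.2 i)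
               else t.2 i == zero_vtree h'] &&
    (\sum_i top_value (t.2 i) == d%:R * t.1 - c)
  else fun _ => true.

Let q (h : nat) : K := (geom (d - 1) h)%:R.

Fixpoint kernel_dim (h : nat) : nat :=
  if h is h'.+1 then
    ((d - 1) * kernel_dim h' +
     if ((geom (d - 1) h)%:R == 0 :> K)%R then d - 2 else 0)%N
  else 0%N.

Lemma geomS (a h : nat) : geom a h.+1 = (1 + a * geom a h)%N.
Proof.
rewrite /geom big_ord_recl expn0 big_distrr; congr (_ + _)%N.
by apply: eq_bigr => i _; rewrite expnS.
Qed.

Let qS h : q h.+1 = 1 + (d - 1)%:R * q h.
Proof. by rewrite /q geomS natrD natrM. Qed.

Lemma top_zero_vtree h : top_value (zero_vtree h) = 0.
Proof. by case: h. Qed.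

(** For the children, the top value r is the value at the parent, so [card_family_sum] applies with
    al = q_(h+1), e = q_h r and z = d r - c. *)
Let harmonic_step (h M : nat) (up : option 'I_d) (c r : K) :
  (forall i s, #|[set t : vtree h | harmonic (Some i) r t & top_value t == s]| =
     (M * (q h.+1 * s == q h * r)%R)%N) ->
  (0 < #|[pred i | Some i != up]|)%N ->
  #|[set t : vtree h.+1 | harmonic up c t & top_value t == r]| =
  (M ^ #|[pred i | Some i != up]| *
   if (q h.+1 == 0)%R
   then (q h * r == 0)%R * #|K| ^ #|[pred i | Some i != up]|.-1
   else nat_of_bool (#|[pred i | Some i != up]|%:R * (q h * r) ==
                     q h.+1 * (d%:R * r - c))%R)%N.
Proof.
move=> IH up_gt0; set P := [pred i | _].
rewrite -(@card_family_sum K 'I_d P up_gt0 (vtree h) (@top_value h)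
  (fun i => if P i then harmonic (Some i) r else pred1 (zero_vtree h))
  M _ _ (d%:R * r - c) (zero_vtree h)); last first.
- exact: top_zero_vtree.
- by move=> i /negPf->.
- by move=> i s Pi; rewrite Pi IH.
rewrite -[RHS](@card_imset _ _ (pair r)); last by move=> g g' [].
apply: eq_card => -[x g]; rewrite !inE /=.
have PE i t : (if P i then harmonic (Some i) r else pred1 (zero_vtree h)) t =
    if Some i != up then harmonic (Some i) r t else t == zero_vtree h.
  by rewrite /P /=; case: ifP.
apply/andP/imsetP => [[/andP[/forallP gP gs] /eqP xr]|[g']].
  exists g; rewrite -xr // inE gs andbT; apply/forallP => i.
  by rewrite xr PE -xr.
rewrite inE => /andP[/forallP gP gs] [-> ->]; rewrite gs eqxx; split=> //.
by rewrite andbT; apply/forallP => i; rewrite -PE; apply: gP.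
Qed.

Lemma card_harmonic (h : nat) (j : 'I_d) (c r : K) :
  #|[set t : vtree h | harmonic (Some j) c t & top_value t == r]| =
  (#|K| ^ kernel_dim h * (q h.+1 * r == q h * c)%R)%N.
Proof.
elim: h j c r => [|h IH] j c r.
  have -> : q 1 = 1 by rewrite qS /q /geom big_ord0 mulr0 addr0.
  rewrite /q /geom big_ord0 mul0r mul1r expn0 mul1n; case: (r =P 0) => r0.
    rewrite (eq_card (B := [set tt])) ?cards1 // => -[].
    by rewrite !inE /= r0 !eqxx.
  apply: eq_card0 => t; rewrite !inE /= eq_sym; apply: introF eqP r0.
have cP : #|[pred i : 'I_d | Some i != Some j]| = (d - 1)%N.
  rewrite subn1 -[X in X.-1]card_ord -(cardC1 j); apply: eq_card => i.
  by rewrite !inE.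
rewrite (harmonic_step c (fun i s => IH i r s)) cP ?subn_gt0 ?(ltnW d_gt2) //.
have dE : d%:R = 1 + (d - 1)%:R :> K.
  by rewrite -(natrD _ 1) subnKC // (ltn_trans _ d_gt2).
rewrite -expnM [(kernel_dim h * _)%N]mulnC /= -/(q h.+1).
case: (eqVneq (q h.+1) 0) => [q0|q0].
  (* Two consecutive q cannot both vanish. Hence r = 0, the d - 1 child values are constrained only
     by their sum, and q_(h+2) = 1 turns the claimed condition into r = 0 as well. *)
  have qh : q h != 0.
    by apply: contra_eq_neq q0 => qh; rewrite qS qh mulr0 addr0 oner_eq0.
  rewrite [q h.+2]qS q0 mulr0 addr0 mul1r mul0r mulf_eq0 (negPf qh) /=.
  have -> : ((d - 1).-1 = d - 2)%N by rewrite -subn1 -subnDA.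
  by rewrite expnD -mulnA [((r == 0)%R * _)%N]mulnC.
rewrite addn0; congr (_ * nat_of_bool _)%N.
(* The two conditions agree because d q_(h+1) - (d - 1) q_h = q_(h+2). *)
rewrite -subr_eq0 -[RHS]subr_eq0 -[RHS]oppr_eq0 dE; congr (_ == 0).
rewrite [q h.+2]qS [q h.+1]qS; ring.
Qed.

(** The top value r must be 0. If q_(n+1) = 0 then q_n is nonzero and q_n r = 0, leaving d child
    values with sum 0; otherwise the equation at the root reduces to d (d - 1)^n r = 0. *)
Lemma card_harmonic_root (n : nat) :
  d%:R != 0 :> K -> (d - 1)%:R != 0 :> K ->
  #|[set t : vtree n.+1 | harmonic None 0 t]| =
  (#|K| ^ (d * kernel_dim n +
     if ((geom (d - 1) n.+1)%:R == 0 :> K)%R then d - 1 else 0))%N.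
Proof.
move=> d0 a0.
have cP : #|[pred i : 'I_d | Some i != None]| = d.
  by rewrite -[RHS]card_ord; apply: eq_card => i; rewrite !inE.
have dr r : #|[set t : vtree n.+1 | harmonic None 0 t & top_value t == r]| =
   ((r == 0)%R * (#|K| ^ (d * kernel_dim n +
      if (q n.+1 == 0)%R then d - 1 else 0)))%N.
  rewrite (harmonic_step 0 (fun i s => card_harmonic n i r s)) cP.
    2: by rewrite (ltn_trans _ d_gt2).
  rewrite -expnM [(kernel_dim n * _)%N]mulnC expnD mulnCA; congr (_ * _)%N.
  case: (eqVneq (q n.+1) 0) => [q0|q0].
    have qh : q n != 0.
      by apply: contra_eq_neq q0 => qh; rewrite qS qh mulr0 addr0 oner_eq0.
    by rewrite mulf_eq0 (negPf qh) subn1.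
  rewrite expn0 muln1; congr nat_of_bool.
  have qE : q n.+1 = q n + (d - 1)%:R ^+ n.
    by rewrite /q /geom big_ord_recr natrD natrX.
  rewrite -subr_eq0 (_ : _ - _ = - ((d%:R * (d - 1)%:R ^+ n) * r)).
    2: by rewrite qE; ring.
  by rewrite oppr_eq0 mulf_eq0 mulf_eq0 expf_eq0 (negPf d0) (negPf a0) andbF.
rewrite -sum1dep_card (partition_big (@top_value n.+1) predT) //.
under eq_bigr => r _ do rewrite sum1dep_card dr.
rewrite (bigD1 0) //= big1 => [|r /negPf->].
  by rewrite eqxx mul1n addn0.
by rewrite mul0n.
Qed.

End HarmonicTrees.

(** * The collapsed ball *)

Section CollapsedBallLaplacian.
Variables (d n : nat).
Hypothesis d_gt2 : (2 < d)%N.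

Let widen_proof (x : ball d n) : (level (val x) <= n.+1)%N.
Proof. exact: leqW (valP x). Qed.

Let widen (x : ball d n) : ball d n.+1 := Sub (val x) (widen_proof x).

Let collapseE (v : ball d n.+1) x : (collapse v == Some x) = (v == widen x).
Proof.
apply/eqP/eqP => [/collapse_level vx|->]; first by apply: val_inj.
by rewrite /collapse /= valK.
Qed.

Let Bbar_multE x Y : Bbar_mult (Some x) Y =
  #|[set v : ball d n.+1 | collapse v == Y & tree_adj (val x) (val v)]|.
Proof.
rewrite /Bbar_mult -[RHS](@card_imset _ _ (pair (widen x))).
  2: by move=> ? ? [].
apply: eq_card => -[u v]; rewrite inE /= collapseE.
apply/and3P/imsetP => [[/eqP-> vY xv]|].
  by exists v; rewrite // inE vY.
by case=> v'; rewrite inE => /andP[? ?] [-> ->]; rewrite eqxx.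
Qed.

Lemma Bbar_mult_ball (x y : ball d n) :
  Bbar_mult (Some x) (Some y) = tree_adj (val x) (val y).
Proof.
rewrite Bbar_multE; case xy: (tree_adj _ _).
  rewrite (eq_card (B := [set widen y])) ?cards1 // => v.
  rewrite !inE collapseE.
  by case: eqP => // ->.
apply: eq_card0 => v; rewrite !inE collapseE.
by case: eqP => // ->.
Qed.

(** All tree neighbours of x lie in the ball of radius n + 1, and parallel edges to the sink are
    counted with multiplicity, so the collapse loses no edge at x. *)
Lemma degree_Bbar (x : ball d n) : degree (G := Bbar n d_gt2) (Some x) = d.
Proof.
have [s [s_uniq s_size sP]] := tree_regular (val x).
transitivity #|[set v : ball d n.+1 | tree_adj (val x) (val v)]|.
  rewrite -sum1dep_card (partition_big (@collapse d n) predT) //.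
  apply: eq_bigr => Y _; rewrite -[mult _ _]/(Bbar_mult (Some x) Y).
  rewrite Bbar_multE sum1dep_card.
  by apply: eq_card => v; rewrite !inE andbC.
have sn v : v \in s -> (level v <= n.+1)%N.
  have := valP x; rewrite sP => /= xn /tree_adj_level[-> //|vx].
  by apply: ltnW; rewrite -vx; apply: leqW.
transitivity #|(pmap insub s : seq (ball d n.+1))|.
  by apply: eq_card => v; rewrite inE mem_pmap_sub sP.
rewrite (card_uniqP _) ?pmap_sub_uniq // size_pmap_sub -[RHS]s_size.
by apply/eqP; rewrite -all_count; apply/allP.
Qed.

Variable K : finFieldType.
Implicit Types (phi : {ffun ball d n -> K}) (F : seq 'I_d -> K).

Definition ball_harmonic phi : bool :=
  [forall x : ball d n,
     \sum_(y | tree_adj (val x) (val y)) phi y == d%:R * phi x].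

(** Deleting the sink coordinate amounts to the value 0 there: edges to the sink enter the equation
    at x only through its degree d. *)
Lemma card_ker_Bbar :
  #|[set w : 'cV[K]_#|nonsink (Bbar n d_gt2)| |
      map_mx intr (reduced_laplacian (Bbar n d_gt2)) *m w == 0]| =
  #|[set phi | ball_harmonic phi]|.
Proof.
pose G := Bbar n d_gt2.
pose f phi : 'cV[K]_#|nonsink G| := \col_i oapp phi 0 (enum_val i).
have someP x : Some x \in nonsink G by [].
pose ix (x : ball d n) := enum_rank_in (someP x) (Some x).
have ixK x : enum_val (ix x) = Some x by rewrite enum_rankK_in.
have ixE i : exists x, i = ix x.
  case iE: (enum_val i) => [x|]; last by have := enum_valP i; rewrite iE.
  by exists x; apply: enum_val_inj; rewrite ixK.
have fE phi x : f phi (ix x) 0 = phi x by rewrite mxE ixK.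
have fP phi :
    (map_mx intr (reduced_laplacian G) *m f phi == 0) = ball_harmonic phi.
  have LE x : (map_mx intr (reduced_laplacian G) *m f phi) (ix x) 0 =
      \sum_(y | tree_adj (val x) (val y)) phi y - d%:R * phi x.
    rewrite mxE (bigD1 (ix x)) //= fE !mxE eqxx ixK degree_Bbar.
    rewrite intrN mulNr addrC.
    congr (_ - _); transitivity (\sum_(i in nonsink G)
       (mult (Some x : G) i)%:R * oapp phi 0 i).
      rewrite [RHS](@big_enum_val _ _ _ _ (nonsink G)) [RHS](bigD1 (ix x)) //=.
      rewrite ixK Bbar_mult_loopless mul0r add0r; apply: eq_bigr => i ii.
      by rewrite !mxE eq_sym (negPf ii) ixK.
    rewrite (reindex_omap (@Some (ball d n)) id) //=; last by case.
    rewrite [RHS]big_mkcond; apply: eq_big => y; first by rewrite eqxx.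
    by move=> _; rewrite Bbar_mult_ball; case: tree_adj; rewrite ?mul1r ?mul0r.
  apply/eqP/forallP => [L0 x|hphi].
    by rewrite -subr_eq0 -LE L0 mxE.
  apply/colP => i; have [x ->] := ixE i; rewrite LE mxE.
  by apply/eqP; rewrite subr_eq0.
rewrite -[RHS](card_in_imset (f := f)).
  apply: eq_card => w; rewrite !inE.
  apply/idP/imsetP => [w0|[phi + ->]]; last first.
    by rewrite inE fP.
  have wE : w = f [ffun x => w (ix x) 0].
    by apply/colP => i; have [x ->] := ixE i; rewrite fE ffunE.
  by exists [ffun x => w (ix x) 0]; rewrite // inE -fP -wE.
by move=> phi psi _ _ fE'; apply/ffunP => x; rewrite -fE fE' fE.
Qed.

End CollapsedBallLaplacian.

(** * Functions on the ball as recursive trees *)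

Section BallAsTree.
Variables (d n : nat) (K : finFieldType).
Implicit Types (phi : {ffun ball d n -> K}) (F : seq 'I_d -> K).
Implicit Types (s v : seq 'I_d).

Let neq : rel 'I_d := fun i j => i != j.

(** At most one term occurs: this is the extension of [phi] by 0 to all words, including those with
    repeated consecutive colours and those longer than n. *)
Definition extend phi s : K := \sum_(y : ball d n | val (val y) == s) phi y.

Lemma extend_val phi (x : ball d n) : extend phi (val (val x)) = phi x.
Proof. by rewrite /extend (big_pred1 x). Qed.

Lemma extend_out phi s :
  ~~ (sorted neq s && (size s <= n)%N) -> extend phi s = 0.
Proof.
move=> sP; rewrite /extend big_pred0 // => y; apply: contraNF sP => /eqP<-.
by apply/andP; split; [exact: valP (val y) | exact: valP y].
Qed.

Definition parent_value F s : K := if s is _ :: s' then F s' else 0.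

Lemma sum_adj_extend phi (x : ball d n) (w := val (val x)) :
  \sum_(y | tree_adj (val x) (val y)) phi y =
  parent_value (extend phi) w + \sum_i extend phi (i :: w).
Proof.
have downE : \sum_i extend phi (i :: w) =
    \sum_(y : ball d n | [exists i, val (val y) == i :: w]) phi y.
  rewrite /extend (exchange_big_dep
    (fun y : ball d n => [exists i, val (val y) == i :: w])) /=.
    2: by move=> i y _ yi; apply/existsP; exists i.
  apply: eq_bigr => y /existsP[i /eqP yi]; rewrite (big_pred1 i) // => j.
  by rewrite yi /= eqseq_cons eqxx andbT eq_sym.
have upE : parent_value (extend phi) w =
    \sum_(y : ball d n | [exists i, w == i :: val (val y)]) phi y.
  rewrite /parent_value; case: w {downE} => [|j s].
    by rewrite big_pred0 // => y; apply/existsP => -[].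
  apply: eq_bigl => y; apply/eqP/existsP => [<-|[i /eqP[_ ->] //]].
  by exists j.
rewrite upE downE.
rewrite (bigID (fun y : ball d n => [exists i, w == i :: val (val y)])) /=.
congr (_ + _); apply: eq_bigl => y; rewrite /tree_adj -/w.
  by case: [exists i, w == _]; rewrite ?orbT ?andbF.
case: existsP => [[i /eqP yi]|_] /=; last by rewrite andbN.
apply/negP => /existsP[j /eqP wj].
have := congr1 size yi; rewrite wj /=; lia.
Qed.

Fixpoint unfold F (h : nat) s : vtree K d h :=
  if h is h'.+1 then (F s, [ffun i => unfold F h' (i :: s)]) else tt.

(** The path is read from the top down, whereas vertices of the tree are words with the last step
    first; hence the [rev] when the two are compared. *)
Fixpoint lookup (h : nat) : vtree K d h -> seq 'I_d -> K :=
  if h is h'.+1 then fun t v => if v is i :: v' then lookup (t.2 i) v' else t.1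
  else fun _ _ => 0.

Lemma lookup_zero h v : lookup (zero_vtree K d h) v = 0.
Proof. by elim: h v => [|h IH] [|i v] //=; rewrite ffunE. Qed.

Lemma lookup_long h (t : vtree K d h) v : (h <= size v)%N -> lookup t v = 0.
Proof. by elim: h t v => [|h IH] t [|i v] //= /IH. Qed.

Lemma lookup_unfold F h s v :
  (size v < h)%N -> lookup (unfold F h s) (rev v) = F (v ++ s).
Proof.
elim: h s v => [|h IH] s v //; case/lastP: v => [|v i] //=.
by rewrite size_rcons ltnS rev_rcons /= ffunE cat_rcons => /IH.
Qed.

Lemma unfold_lookup F h (t : vtree K d h) s :
  (forall v, F (v ++ s) = lookup t (rev v)) -> unfold F h s = t.
Proof.
elim: h t s => [[]|h IH [x g]] s Ft //=; congr pair; first exact: (Ft [::]).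
apply/ffunP => i; rewrite ffunE; apply: IH => v.
by rewrite -cat_rcons Ft rev_rcons.
Qed.

(** A path that repeats a colour at once turns back towards a parent, into a branch that [harmonic]
    forces to be zero. *)
Lemma lookup_harmonic h (t : vtree K d h) up c v : harmonic up c t ->
  ~~ sorted neq v || (if v is i :: _ then Some i == up else false) ->
  lookup t v = 0.
Proof.
elim: h t up c v => [|h IH] t up c [|i v] //= /andP[/forallP/(_ i) + _].
case: ifPn => [iup ti|_ /eqP-> _]; last exact: lookup_zero.
rewrite (negPf iup) orbF => iv; apply: (IH _ _ _ _ ti).
case: v iv => //= j v; rewrite negb_and negbK => /orP[/eqP->|->] //.
by rewrite eqxx orbT.
Qed.

(** The condition on h + size s puts the bottom of the tree just above level n + 1, where [F]
    vanishes. The empty [v] gives the equation at the top, and the [v] with last letter i give those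
    in branch i. *)
Lemma harmonic_unfold F h s : (h + size s = n.+1)%N ->
  (forall s, ~~ (sorted neq s && (size s <= n)%N) -> F s = 0) ->
  sorted neq s ->
  reflect (forall v, (size v < h)%N -> sorted neq (v ++ s) ->
      parent_value F (v ++ s) + \sum_i F (i :: v ++ s) = d%:R * F (v ++ s))
    (harmonic (ohead s) (parent_value F s) (unfold F h s)).
Proof.
move=> hs Fout; elim: h s hs => [|h IH] s hs sP; first by apply: ReflectT.
have top i : top_value (unfold F h (i :: s)) = F (i :: s).
  (* At height 0 the stored value is 0, and so is [F], since i :: s has length n + 1. *)
  case: h {IH} hs => //=; rewrite add1n => -[sn].
  by rewrite Fout // negb_and -ltnNge /= sn leqnn orbT.
have sumE : (\sum_i top_value ([ffun i => unfold F h (i :: s)] i) ==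
    d%:R * F s - parent_value F s) =
    (parent_value F s + \sum_i F (i :: s) == d%:R * F s).
  under eq_bigr do rewrite ffunE top.
  by rewrite eq_sym subr_eq eq_sym addrC.
have hSs i : (h + size (i :: s) = n.+1)%N by rewrite /= addnS.
rewrite /= sumE; apply: (iffP andP) => [[/forallP ch /eqP rt]|Fh].
  elim/last_ind => [|v i _] //; rewrite size_rcons ltnS cat_rcons => vh vs.
  have isP : sorted neq (i :: s).
    by move: vs; rewrite sorted_cat_cons => /andP[].
  have iup : Some i != ohead s.
    by case: s isP {ch rt vs hs sP top sumE hSs IH} => //= j s /andP[].
  have := ch i; rewrite iup ffunE => /(IH _ (hSs i) isP); exact.
split; last by apply/eqP; apply: (Fh [::]).
apply/forallP => i; rewrite ffunE; case: ifPn => iup.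
  have isP : sorted neq (i :: s).
    by case: s iup sP {hs Fh top sumE hSs IH} => //= j s ij ->; rewrite andbT.
  apply/(IH _ (hSs i) isP) => v vh; rewrite -cat_rcons; apply: Fh.
  by rewrite size_rcons ltnS.
(* The branch i towards the parent: its words contain i twice in a row, so [F] is 0 on it. *)
apply/eqP/unfold_lookup => v; rewrite lookup_zero Fout // negb_and.
apply/orP; left.
case: s iup {hs sP Fh top sumE hSs IH} => // j s; rewrite negbK => /eqP[<-].
by rewrite sorted_cat_cons /= /neq eqxx andbF.
Qed.

(** Unfolding from the root is a bijection, with [lookup] along reversed words as inverse; off the
    ball both sides are 0. *)
Lemma card_ball_harmonic :
  #|[set phi | @ball_harmonic d n K phi]| =
  #|[set t : vtree K d n.+1 | harmonic None 0 t]|.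
Proof.
pose f phi := unfold (extend phi) n.+1 [::].
have fP phi : reflect (ball_harmonic phi) (harmonic None 0 (f phi)).
  apply: (iffP (@harmonic_unfold (extend phi) n.+1 [::] _ _ _));
    rewrite ?addn0 //.
  - exact: extend_out.
  - move=> H; apply/forallP => x; rewrite sum_adj_extend -[phi x]extend_val.
    have := H (val (val x)); rewrite cats0 => -> //; first exact: valP x.
    exact: valP (val x).
  - move=> /forallP H v vn; rewrite cats0 => vP.
    have /eqP := H (Sub (Sub v vP) vn); rewrite sum_adj_extend => ->.
    by rewrite -(extend_val phi (Sub (Sub v vP) vn)).
rewrite -(card_in_imset (f := f)).
  apply: eq_card => t; rewrite inE; apply/imsetP/idP => [[phi + ->]|tP].
    by rewrite inE => /fP.
  pose phi : {ffun ball d n -> K} := [ffun x => lookup t (rev (val (val x)))].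
  have ft : f phi = t.
    apply: unfold_lookup => v; rewrite cats0.
    have [vP|vP] := boolP (sorted neq v); last first.
      rewrite extend_out ?(negPf vP) // (lookup_harmonic tP) // rev_sorted.
      by rewrite (eq_sorted (e' := neq)) ?vP // => i j; rewrite /neq eq_sym.
    have [vn|vn] := leqP (size v) n; last first.
      by rewrite extend_out ?lookup_long ?size_rev // vP -ltnNge.
    have := extend_val phi (Sub (Sub v vP) vn); rewrite ffunE; apply.
  by exists phi; rewrite // inE; apply/fP; rewrite ft.
move=> phi psi _ _ fE; apply/ffunP => x; rewrite -!(extend_val _ x).
have xn : (size (val (val x)) < n.+1)%N by exact: valP x.
by rewrite -[val (val x)]cats0 -!(lookup_unfold _ _ xn) -/(f _) fE.
Qed.

End BallAsTree.

(** * The rank *)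

Section GeometricPeriod.
Variables (a p t : nat).
Hypotheses (p_prime : prime p) (p_ndvd_a : ~~ (p %| a)%N).
Hypotheses (t_gt0 : (0 < t)%N) (t_dvd : (p %| geom a t)%N).
Hypothesis t_least :
  forall m : nat, (0 < m)%N -> (p %| geom a m)%N -> (t <= m)%N.

Lemma geomD (m k : nat) : geom a (m + k) = (geom a m + a ^ m * geom a k)%N.
Proof.
rewrite /geom big_split_ord big_distrr; congr (_ + _)%N.
by apply: eq_bigr => i _; rewrite /= expnD.
Qed.

(** Since q_(t+r) = q_t + a^t q_r with a invertible mod p, divisibility of q_h by p has period t in
    h; minimality of t excludes nonzero remainders. *)
Lemma dvdn_geom (h : nat) : (p %| geom a h)%N = (t %| h)%N.
Proof.
have geom_period k r : (p %| geom a (k * t + r))%N = (p %| geom a r)%N.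
  elim: k => [|k IH]; first by rewrite mul0n.
  rewrite mulSn -addnA geomD dvdn_addr // Gauss_dvdr ?IH //.
  by rewrite coprimeXr // prime_coprime.
rewrite [in LHS](divn_eq h t) geom_period [RHS]/dvdn.
have [->|r_gt0] := posnP (h %% t)%N; first by rewrite /geom big_ord0 dvdn0.
apply/negbTE; apply: contraL (ltn_pmod h t_gt0).
by rewrite -leqNgt; apply: t_least.
Qed.

End GeometricPeriod.

(** Multiplying the sum for n by d - 1 shifts m and n together, which keeps the congruence; the term
    m = 0 of the sum for n + 1 is the one added when t divides n + 1. *)
Lemma kernel_dimE (d p t : nat) : prime p ->
  (forall h, (p %| geom (d - 1) h)%N = (t %| h)%N) ->
  forall n, kernel_dim 'F_p d n =
    ((d - 2) * \sum_(0 <= m < n | m == n %[mod t]) (d - 1) ^ m)%N.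
Proof.
move=> p_prime pt; elim=> [|n IH]; first by rewrite big_nil muln0.
rewrite /= IH -(dvdn_pcharf (pchar_Fp p_prime)) pt.
rewrite [in RHS]big_mkcond big_nat_recl //= -big_mkcond expn0 mulnDr addnC.
congr (_ + _)%N.
  rewrite mod0n eq_sym -/(t %| n.+1)%N.
  by case: ifP; rewrite ?muln1 ?muln0.
rewrite mulnCA big_distrr; congr (_ * _)%N; apply: eq_big => m.
  by rewrite -(addn1 m) -(addn1 n) eqn_modDr.
by rewrite expnS.
Qed.

Local Open Scope nat_scope.

Theorem theorem5p1 (d n p t : nat) (hd : 2 < d) (hn : 0 < n)
    (p_prime : prime p) (p_ndvd : ~~ (p %| d * (d - 1)))
    (t_gt0 : 0 < t) (t_dvd : p %| geom (d - 1) t)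
    (t_least : forall m : nat, 0 < m -> p %| geom (d - 1) m -> t <= m)
    (S : {group sandpile (Bbar n hd)})
    (S_sylow : (p.-Sylow([set: sandpile (Bbar n hd)]) S)%g) :
  ('m(S))%g =
    if (n%:Z == -1 %[mod t])%Z then
      d * (d - 2) * (\sum_(0 <= m < n | m == n %[mod t]) (d - 1) ^ m)
        + (d - 1)
    else d * (d - 2) * (\sum_(0 <= m < n | m == n %[mod t]) (d - 1) ^ m).
Proof.
have [p_ndvd_d p_ndvd_a] : ~~ (p %| d)%N /\ ~~ (p %| d - 1)%N.
  by move: p_ndvd; rewrite Euclid_dvdM // negb_or => /andP.
have pt := dvdn_geom p_prime p_ndvd_a t_gt0 t_dvd t_least.
have Fp0 m : (m%:R == 0 :> 'F_p)%R = (p %| m).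
  by rewrite (dvdn_pcharf (pchar_Fp p_prime)).
rewrite (grank_Sylow_abelian p_prime _ S_sylow).
  2: exact: FinRing.zmod_abelian.
rewrite card_Ldiv_sandpile // card_ker_Bbar card_ball_harmonic.
rewrite card_harmonic_root ?Fp0 // card_Fp // pfactorK //.
rewrite (kernel_dimE p_prime pt).
(* The extra d - 1 occurs when p divides q_(n+1), that is when t divides n + 1, which is the
   congruence n = -1 mod t. *)
rewrite pt mulnA eqz_mod_dvd opprK -PoszD addn1.
rewrite -[(_ %| _)%Z]/(t %| n.+1).
by case: ifP; rewrite ?addn0.
Qed.
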